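(* In the setting of the context, let $J=[c-\varepsilon_Z,c+\varepsilon_Z]$ (an interval which contains at least $d+t$ eigenvalues of $T$ counted with multiplicity), and suppose $J$ lies in an isolated spectral interval $I$ of $A$. Let $P_I$ be the spectral projector of $A$ onto $I$, and set $r=\operatorname{rank}(P_I)$. Choose $q=d+t$ orthonormal eigenvectors $z_1,\ldots,z_q$ of $T$ whose eigenvalues $\theta_1,\ldots,\theta_q$ lie in $J$. Suppose $Vz_i\ne0$, and put $$y_i=\frac{Vz_i}{\|Vz_i\|_2},\qquad \mathcal Y=[\,y_1\ \cdots\ y_q\,].$$ Let $\rho\ge0$ and $\gamma>0$. If $$\|Ay_i-\theta_iy_i\|_2\le\rho,\qquad \operatorname{dist}(\theta_i,\sigma(A)\setminus I)\ge\gamma>0\qquad(1\le i\le q)$$ and $q>r$, then $$\sigma_{r+1}(\mathcal Y)\le\sqrt q\,\frac{\rho}{\gamma}.$$ Consequently, every $\eta\ge\sqrt q\,\rho/\gamma$ satisfies $\operatorname{rank}_\eta(\mathcal Y)\le r$. At least $q-r$ of the reported directions are then redundant in the original vector space (i.e. $q-\operatorname{rank}_\eta(\mathcal Y)\ge q-r$).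
   Context: $A=A^T\in\mathbb R^{n\times n}$; $V=[V_1\ \cdots\ V_k]\in\mathbb R^{n\times m}$ with $V_i\in\mathbb R^{n\times r_i}$, $V_i^TV_i=I_{r_i}$, $m=\sum_ir_i$; $T=T^T\in\mathbb R^{m\times m}$ is block tridiagonal (the projected matrix of a computed block Lanczos recurrence $AV=VT+WHE_k^T+F$, where $W\in\mathbb R^{n\times s}$ has orthonormal columns, $H\in\mathbb R^{s\times r_k}$, $F\in\mathbb R^{n\times m}$, and $E_k$ injects into the last block). $G=V^TV$, $\mathcal E=TG-GT$. Given $1\le d\le m$, $Z\in\mathbb R^{m\times d}$ with $Z^TZ=I_d$, and $c\in\mathbb R$, set $R_Z=(T-cI)Z$, $K_Z=Z^TGZ$, $W_Z=(I-ZZ^T)GZ$. For an integer $1\le t\le\operatorname{rank}(W_Z)$ take $t$ leading singular triplets $W_ZP_W=Q_W\Sigma_W$ with $Q_W\in\mathbb R^{m\times t}$, $P_W\in\mathbb R^{d\times t}$ having orthonormal columns and $\Sigma_W$ diagonal with positive entries, and set $$\varepsilon_Z=\left\|\left[\,R_Z\quad(\mathcal EZ+GR_Z-R_ZK_Z)P_W\Sigma_W^{-1}\right]\right\|_2 .$$ $\sigma(A)$ is the spectrum of $A$; $\sigma_j(Y)$ is the $j$th largest singular value of $Y$, padded with zeros when the index exceeds the smaller matrix dimension. For $\eta\ge0$, $\operatorname{rank}_\eta(Y)=\#\{i:\sigma_i(Y)>\eta\}$. The numerical redundancy (ghost multiplicity) of $q$ normalized Ritz vectors collected in $Y$ is $q-\operatorname{rank}_\eta(Y)$.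 *)

(* Defs.v *)
From mathcomp Require Export all_boot all_order all_algebra.
From mathcomp Require Export all_classical all_reals normedtype.
From mathcomp Require Import polyrcf.
Set Implicit Arguments.
Unset Strict Implicit.
Unset Printing Implicit Defensive.
Import Order.TTheory GRing.Theory Num.Theory numFieldNormedType.Exports.
Local Open Scope classical_set_scope.
Local Open Scope ring_scope.

(* The norm `|v| that MathComp-Analysis puts on matrices is the max norm, hence
   the explicit Euclidean norm and the operator norm it induces. *)
Definition norm2 (R : realType) n (v : 'cV[R]_n) : R :=
  Num.sqrt (\sum_i v i 0 ^+ 2).

Definition mxnorm2 (R : realType) p q (X : 'M[R]_(p, q)) : R :=
  sup [set norm2 (X *m v) | v in [set v : 'cV[R]_q | norm2 v <= 1]].

(* The real roots of the characteristic polynomial with their multiplicities,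
   in nonincreasing order: for symmetric X, these are all n eigenvalues. *)
Definition eigenvalues (R : realType) n (X : 'M[R]_n) : seq R :=
  sort >=%R (flatten [seq nseq (mup x (char_poly X)) x
                     | x <- rootsR (char_poly X)]).

(* Real spectrum; this is the whole spectrum when X is symmetric. *)
Definition spectrum (R : realType) n (X : 'M[R]_n) : set R :=
  [set x | eigenvalue X x].

Definition singular_values (R : realType) p q (Y : 'M[R]_(p, q)) : seq R :=
  [seq Num.sqrt x | x <- eigenvalues (Y^T *m Y)].

(* sigma j Y is the j-th largest singular value, counted from j = 1; nth returns
   0 beyond the end of the list. *)
Definition sigma (R : realType) (j : nat) p q (Y : 'M[R]_(p, q)) : R :=
  (singular_values Y)`_(j.-1).

Definition num_rank (R : realType) (eta : R) p q (Y : 'M[R]_(p, q)) : nat :=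
  count (fun s => eta < s) (singular_values Y).

Definition redundancy (R : realType) (eta : R) p q (Y : 'M[R]_(p, q)) : nat :=
  (q - num_rank eta Y)%N.

(* MathComp eigenspaces consist of row vectors and are here intended for
   symmetric A. The sum of the eigenspaces for the eigenvalues outside I is then
   the orthogonal complement of the sum for those in I, and the projection below
   is the (symmetric) matrix of the orthogonal projector onto the latter. *)
Definition spectral_projector (R : realType) n (A : 'M[R]_n) (I : interval R) :
    'M[R]_n :=
  proj_mx (\sum_(x <- eigenvalues A | x \in I) eigenspace A x)%MS
          (\sum_(x <- eigenvalues A | x \notin I) eigenspace A x)%MS.

(* The interval lies at positive distance from the rest of the spectrum; the
   distance to the empty set is +oo. *)
Definition isolated_spectral_interval (R : realType) n (A : 'M[R]_n)
    (I : interval R) : Prop :=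
  exists2 delta : R, 0 < delta &
    forall x, x \in I ->
      (delta%:E <= edist_inf (spectrum A `\` [set` I]) x)%E.

Definition block_tridiagonal (R : realType) k (b : 'I_k -> nat)
    (T : 'M[R]_(\sum_i b i)) : Prop :=
  forall i j : 'I_k, (i.+1 < j)%N || (j.+1 < i)%N -> submxblock T i j = 0.

(* E_k, i.e. the last block of columns of the identity matrix. *)
Definition last_block (R : realType) k (b : 'I_k.+1 -> nat) :
    'M[R]_(\sum_i b i, b ord_max) :=
  submxrow 1%:M ord_max.

Definition defect (R : realType) m (T G : 'M[R]_m) : 'M[R]_m :=
  T *m G - G *m T.

Definition RZ (R : realType) m d (T : 'M[R]_m) (c : R) (Z : 'M[R]_(m, d)) :
    'M[R]_(m, d) :=
  (T - c%:M) *m Z.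

Definition KZ (R : realType) m d (G : 'M[R]_m) (Z : 'M[R]_(m, d)) : 'M[R]_d :=
  Z^T *m G *m Z.

Definition WZ (R : realType) m d (G : 'M[R]_m) (Z : 'M[R]_(m, d)) :
    'M[R]_(m, d) :=
  (1%:M - Z *m Z^T) *m G *m Z.

(* The columns of Q and P and the entries of s are t leading singular triplets
   of X. *)
Definition leading_singular_triplets (R : realType) p q t (X : 'M[R]_(p, q))
    (Q : 'M[R]_(p, t)) (s : 'rV[R]_t) (P : 'M[R]_(q, t)) : Prop :=
  [/\ Q^T *m Q = 1%:M,
      P^T *m P = 1%:M,
      X *m P = Q *m diag_mx s,
      X^T *m Q = P *m diag_mx s &
      forall i : 'I_t, s 0 i = sigma i.+1 X].

Definition epsZ (R : realType) m d t (T G : 'M[R]_m) (c : R)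
    (Z : 'M[R]_(m, d)) (P : 'M[R]_(d, t)) (s : 'rV[R]_t) : R :=
  let RZ := RZ T c Z in
  mxnorm2 (row_mx RZ ((defect T G *m Z + G *m RZ - RZ *m KZ G Z)
                        *m P *m invmx (diag_mx s))).

(* Main.v *)
(* Spectral counting by test spaces: if M has independent rows and the weighted
   sum of squares sum_i e_i w_i^2 is at most C sum_i w_i^2 for every w in the
   row space of M, then at least rank M of the weights e_i are at most C.

   Applied to e_i = (theta_i - c)^2 and the range of S = [Z Q_W], this gives the
   d + t eigenvalues of T in J: the columns of S are orthonormal, and
   (T - c) W_Z = E Z + G R_Z - R_Z K_Z makes eps_Z the norm of (T - c) S.

   Applied to the eigenvalues of Y^T Y and the space of v with P_I Y v = 0, of
   dimension at least q - r, it bounds sigma_{r+1}(Y): in an orthonormal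
   eigenbasis of A, the components of y_i outside I have total square at most
   (rho / gamma)^2, and Cauchy-Schwarz bounds |Y v| by sqrt q (rho / gamma) |v|.
*)
Require Import Defs.
From mathcomp Require Import polyrcf complex lra ring spectral.
Set Implicit Arguments.
Unset Strict Implicit.
Unset Printing Implicit Defensive.
Import Order.TTheory GRing.Theory Num.Theory numFieldNormedType.Exports.
Local Open Scope classical_set_scope.
Local Open Scope ring_scope.

(** * Real spectral theorem for symmetric matrices *)

Lemma mul_row_tr (R : comNzRingType) n (x : 'rV[R]_n) :
  (x *m x^T) 0 0 = \sum_i x 0 i ^+ 2.
Proof. by rewrite mxE; apply: eq_bigr => i _; rewrite mxE. Qed.

Lemma mul_row_tr_gt0 (R : realDomainType) n (x : 'rV[R]_n) :
  x != 0 -> 0 < (x *m x^T) 0 0.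
Proof.
move=> x0; rewrite mul_row_tr lt_def sumr_ge0 ?andbT => [|i _]; last first.
  exact: sqr_ge0.
apply: contra x0; rewrite psumr_eq0 => [/allP h|i _]; last exact: sqr_ge0.
apply/eqP/rowP => i; rewrite mxE.
by have := h i (mem_index_enum _); rewrite sqrf_eq0 => /eqP.
Qed.

(** For a left eigenvector [w] with conjugate [w'], evaluating [w *m A *m w'^T] from either side
    gives both [l] and its conjugate times the nonzero squared length of [w]. *)
Lemma eigenvalue_sym_real (C : numClosedFieldType) n (A : 'M[C]_n) (l : C) :
  A^T = A -> map_mx Num.conj A = A -> eigenvalue A l -> l \is Num.real.
Proof.
move=> symA realA /eigenvalueP[w wA w0].
pose w' := map_mx Num.conj w.
have w'A : w' *m A = l^* *: w'.
  by rewrite -{1}realA -map_mxM wA map_mxZ.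
have ww : (w *m w'^T) 0 0 != 0.
  rewrite mxE psumr_eq0 => [|i _]; last by rewrite !mxE mul_conjC_ge0.
  apply: contra w0 => /allP h; apply/eqP/rowP => i; rewrite mxE.
  have := h i (mem_index_enum _).
  by rewrite !mxE mul_conjC_eq0 => /eqP.
have : l *: (w *m w'^T) = l^* *: (w *m w'^T).
  have -> : l^* *: (w *m w'^T) = w *m (l^* *: w')^T.
    by rewrite linearZ /= scalemxAr.
  by rewrite -w'A trmx_mul symA mulmxA wA scalemxAl.
move/matrixP/(_ 0 0); rewrite [LHS]mxE [RHS]mxE => /(mulIf ww) lE.
by apply/CrealP.
Qed.

(* M need not be symmetric, but each of its complex eigenvalues is one of A. *)
Lemma stable_sym_eigenvalue (R : rcfType) n p (A : 'M[R]_n) (B : 'M[R]_(p, n))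
    (M : 'M[R]_p) :
  A^T = A -> (0 < p)%N -> row_free B -> B *m A = M *m B ->
  exists a, eigenvalue M a.
Proof.
move=> symA p0 freeB BA.
pose f : {rmorphism R -> R[i]} := real_complex R.
have [l lM] := eigenvalue_closed (map_mx f M) p0.
have lA : eigenvalue (map_mx f A) l.
  have /eigenvalueP[v vM v0] := lM.
  apply/eigenvalueP; exists (v *m map_mx f B).
    by rewrite -mulmxA -map_mxM BA map_mxM mulmxA vM scalemxAl.
  apply: contra v0 => /eqP vB.
  have : row_free (map_mx f B) by rewrite row_free_map.
  by move/row_free_inj => inj; apply/eqP/inj; rewrite vB mul0mx.
have /CrealP lr : l \is Num.real.
  apply: eigenvalue_sym_real lA; first by rewrite map_trmx symA.
  by apply/matrixP => i j; rewrite !mxE; exact: conjc_real.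
exists (complex.Re l).
have <- := eigenvalue_map f M (complex.Re l).
suff -> : f (complex.Re l) = l by [].
(* The real part is half the sum of [l] and its conjugate, which is [l] again. *)
rewrite [LHS](ReJ_add l) -[X in _ + X]/(Num.conj l) lr.
by rewrite -mulr2n -(mulr_natr l 2) mulfK // pnatr_eq0.
Qed.

(** Induction on [k] with [A] fixed: the orthogonal complement of the eigenvectors found so far is
    stable under [A] and, while [k < n], nonzero, so it contains another real eigenvector. *)
Lemma orthonormal_eigenvectors (R : rcfType) n (A : 'M[R]_n) k :
  A^T = A -> (k <= n)%N ->
  exists (U : 'M[R]_(k, n)) (D : 'rV[R]_k),
    U *m U^T = 1%:M /\ U *m A = diag_mx D *m U.
Proof.
move=> symA; elim: k => [|k IHk] kn.
  by exists 0, 0; split; apply/matrixP => -[].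
have [U [D [UU UA]]] := IHk (ltnW kn).
pose B := row_base (kermx U^T).
have BU : B *m U^T = 0 by apply/sub_kermxP; rewrite /B eq_row_base.
(* [M] is the matrix of [A] restricted to the complement, in the basis [B]. *)
have /submxP[M BA] : (B *m A <= B)%MS.
  rewrite /B eq_row_base; apply/sub_kermxP.
  by rewrite -mulmxA -{1}symA -trmx_mul UA trmx_mul mulmxA BU mul0mx.
have p0 : (0 < \rank (kermx U^T))%N.
  rewrite mxrank_ker subn_gt0; apply: leq_ltn_trans kn; exact: rank_leq_col.
have freeB : row_free B by exact: row_base_free.
have [a /eigenvalueP[u uM u0]] := stable_sym_eigenvalue symA p0 freeB BA.
pose w := u *m B.
have w0 : w != 0.
  apply: contra u0 => /eqP uB; apply/eqP/(row_free_inj freeB).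
  by rewrite -/w uB mul0mx.
have wA : w *m A = a *: w by rewrite /w -mulmxA BA mulmxA uM scalemxAl.
have wU : w *m U^T = 0 by rewrite /w -mulmxA BU mulmx0.
have ww := mul_row_tr_gt0 w0; set N := (w *m w^T) 0 0 in ww.
pose x := (Num.sqrt N)^-1 *: w.
have xx : x *m x^T = 1%:M.
  rewrite /x linearZ /= -scalemxAl -scalemxAr scalerA [w *m _]mx11_scalar -/N.
  rewrite -invfM -expr2 sqr_sqrtr ?ltW // scale_scalar_mx mulVf //.
  by rewrite gt_eqF.
have xU : x *m U^T = 0 by rewrite -scalemxAl wU scaler0.
have Ux : U *m x^T = 0 by rewrite -[LHS]trmxK trmx_mul trmxK xU trmx0.
have VV : col_mx x U *m (col_mx x U)^T = 1%:M.
  by rewrite tr_col_mx mul_col_row xx xU UU Ux -scalar_mx_block.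
have VA : col_mx x U *m A = diag_mx (row_mx (const_mx a) D) *m col_mx x U.
  rewrite diag_mx_row mul_col_mx mul_block_col !mul0mx addr0 add0r UA.
  by rewrite diag_const_mx mul_scalar_mx -scalemxAl wA scalerA mulrC -scalerA.
exists (col_mx x U : 'M_(1 + k, n)), (row_mx (const_mx a) D : 'rV_(1 + k)).
by split; [exact: VV | exact: VA].
Qed.

Lemma spectral_theorem (R : rcfType) n (A : 'M[R]_n) : A^T = A ->
  exists (U : 'M[R]_n) (D : 'rV[R]_n),
    [/\ U *m U^T = 1%:M, U^T *m U = 1%:M & U *m A = diag_mx D *m U].
Proof.
move=> symA; have [U [D [UU UA]]] := orthonormal_eigenvectors symA (leqnn n).
by exists U, D; split=> //; exact: mulmx1C.
Qed.

(** * The eigenvalue list read off from a diagonalization *)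

Lemma perm_eigenvalues (R : realType) n (A U : 'M[R]_n) (D : 'rV[R]_n) :
  U *m U^T = 1%:M -> U *m A = diag_mx D *m U ->
  perm_eq (eigenvalues A) [seq D 0 i | i <- enum 'I_n].
Proof.
move=> UU UA.
pose P := map_mx (@polyC R) U.
have cE : char_poly A = \prod_(x <- [seq D 0 i | i <- enum 'I_n]) ('X - x%:P).
  have dP : \det P != 0.
    have : \det U * \det U^T = 1 by rewrite -det_mulmx UU det1.
    rewrite /P det_map_mx polyC_eq0; apply: contra_eqN => /eqP->.
    by rewrite mul0r eq_sym oner_eq0.
  (* [U] intertwines the two characteristic matrices; cancelling its nonzero determinant identifies
     the characteristic polynomials. *)
  have : char_poly_mx (diag_mx D) *m P = P *m char_poly_mx A.
    rewrite mulmxBl mulmxBr scalar_mxC; congr (_ - _).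
    by rewrite -!map_mxM UA.
  move/(congr1 determinant); rewrite !det_mulmx [RHS]mulrC => /(mulIf dP).
  rewrite -/(char_poly A) => <-.
  rewrite -/(char_poly (diag_mx D)) char_poly_trig ?diag_mx_is_trig //.
  rewrite big_map big_enum; apply: eq_bigr => i _.
  by rewrite mxE eqxx.
have c0 : char_poly A != 0 by rewrite monic_neq0 ?char_poly_monic.
rewrite /eigenvalues perm_sort; apply/allP => x _ /=; apply/eqP.
(* Both lists contain [x] as often as its multiplicity as a root of [char_poly A]. *)
rewrite count_flatten -map_comp sumnE big_map -mu_prod_XsubC -cE.
under eq_bigr do rewrite /= count_nseq.
have uR : uniq (rootsR (char_poly A)) by exact: uniq_roots.
have xR : (x \in rootsR (char_poly A)) = root (char_poly A) x.
  by have := roots_on_rootsR c0 x; rewrite in_itv /= => <-.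
case: (boolP (root (char_poly A) x)) => rx; last first.
  rewrite mupNroot // big1_seq // => y /= yR.
  by case: eqVneq => // yx; move: rx; rewrite -xR -yx yR.
rewrite (bigD1_seq x) ?xR //= eqxx mul1n big1 ?addn0 // => y /negPf yx.
by rewrite yx.
Qed.

Lemma count_eigenvalues (R : realType) n (A U : 'M[R]_n) (D : 'rV[R]_n)
    (P : pred R) :
  U *m U^T = 1%:M -> U *m A = diag_mx D *m U ->
  count P (eigenvalues A) = #|[pred i | P (D 0 i)]|.
Proof.
move=> UU UA; rewrite (permP (perm_eigenvalues UU UA)) count_map.
by rewrite enumT cardE /enum_mem size_filter; apply: eq_count.
Qed.

(** * Counting weights by test spaces *)

Lemma mul_row_tr_orthogonal (R : comNzRingType) n (x : 'rV[R]_n) (U : 'M[R]_n) :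
  U^T *m U = 1%:M -> (x *m U^T) *m (x *m U^T)^T = x *m x^T.
Proof.
by move=> UU; rewrite trmx_mul trmxK mulmxA -(mulmxA x) UU mulmx1.
Qed.

Lemma dim_le_card_weights (R : realFieldType) n p (M : 'M[R]_(p, n))
    (e : 'I_n -> R) (C : R) :
  row_free M ->
  (forall x : 'rV_p,
    \sum_i e i * (x *m M) 0 i ^+ 2 <= C * \sum_i (x *m M) 0 i ^+ 2) ->
  (p <= #|[pred i | (e i <= C)%R]|)%N.
Proof.
move=> freeM hM; set S := [pred i | _].
pose f := @enum_val _ S.
(* It suffices that a vector of the row space vanishing wherever [e i <= C] is zero: the [p] rows
   then stay independent on those columns. *)
suff /eqP <- : row_free (colsub f M) by exact: rank_leq_col.
apply: inj_row_free => v; rewrite mulmx_colsub => vf.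
have w0 i : e i <= C -> (v *m M) 0 i = 0.
  move=> eC; have iS : i \in S by [].
  have := congr1 (fun X : 'rV_#|S| => X 0 (enum_rank_in iS i)) vf.
  by rewrite !mxE -[f _]/(enum_val _) enum_rankK_in.
apply: (row_free_inj freeM); rewrite mul0mx; apply/rowP => i.
rewrite [RHS]mxE; case: (leP (e i) C) => [/w0 //|Ce].
have := hM v; rewrite mulr_sumr -subr_ge0 -sumrB => h.
(* The terms [(C - e j) * w_j ^+ 2] are all nonpositive but have a nonnegative sum, so each is zero,
   and [w_i = 0] where [C < e i]. *)
have t0 j : C * (v *m M) 0 j ^+ 2 - e j * (v *m M) 0 j ^+ 2 <= 0.
  rewrite -mulrBl; case: (leP (e j) C) => [/w0 ->|/ltW eC].
    by rewrite expr0n mulr0.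
  by rewrite mulr_le0_ge0 ?sqr_ge0 // subr_le0.
have : \sum_j (e j * (v *m M) 0 j ^+ 2 - C * (v *m M) 0 j ^+ 2) == 0.
  rewrite eq_le sumr_ge0 ?andbT => [|j _]; last by rewrite -oppr_le0 opprB.
  by rewrite -oppr_ge0 -sumrN; under eq_bigr do rewrite opprB.
rewrite psumr_eq0 => [/allP/(_ i (mem_index_enum _))|j _]; last first.
  by rewrite -oppr_le0 opprB.
by rewrite /= -mulrBl mulf_eq0 subr_eq0 gt_eqF //= sqrf_eq0 => /eqP.
Qed.

(** * Cauchy-Schwarz, Euclidean norm and operator norm *)

Lemma cauchy_schwarz_sum (R : realDomainType) (I : finType) (a b : I -> R) :
  (\sum_i a i * b i) ^+ 2 <= (\sum_i a i ^+ 2) * (\sum_i b i ^+ 2).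
Proof.
have : 0 <= \sum_i \sum_j (a i * b j - a j * b i) ^+ 2.
  by apply: sumr_ge0 => i _; apply: sumr_ge0 => j _; exact: sqr_ge0.
(* Lagrange's identity. *)
have -> : \sum_i \sum_j (a i * b j - a j * b i) ^+ 2 =
    ((\sum_i a i ^+ 2) * (\sum_i b i ^+ 2) - (\sum_i a i * b i) ^+ 2) *+ 2.
  rewrite mulrnBl mulr2n {2}[_ * _]mulrC expr2 !mulr_suml -!sumrMnl -big_split.
  rewrite -sumrB; apply: eq_bigr => i _ /=.
  rewrite !mulr_sumr -sumrMnl -big_split -sumrB; apply: eq_bigr => j _ /=.
  by rewrite !mulr2n; ring.
by rewrite pmulrn_lge0 // subr_ge0.
Qed.

Lemma norm2_sqr (R : realType) n (v : 'cV[R]_n) :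
  norm2 v ^+ 2 = \sum_i v i 0 ^+ 2.
Proof. by rewrite sqr_sqrtr // sumr_ge0 // => i _; exact: sqr_ge0. Qed.

Lemma norm2_ge0 (R : realType) n (v : 'cV[R]_n) : 0 <= norm2 v.
Proof. exact: sqrtr_ge0. Qed.

Lemma norm2_sqr_tr (R : realType) n (v : 'cV[R]_n) :
  norm2 v ^+ 2 = (v^T *m v) 0 0.
Proof.
by rewrite norm2_sqr mxE; apply: eq_bigr => i _; rewrite mxE expr2.
Qed.

Lemma norm2Z (R : realType) n (a : R) (v : 'cV[R]_n) :
  norm2 (a *: v) = `|a| * norm2 v.
Proof.
apply/eqP; rewrite -(eqrXn2 (n := 2)) ?mulr_ge0 ?norm2_ge0 //.
rewrite exprMn !norm2_sqr real_normK ?num_real // mulr_sumr.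
by apply/eqP; apply: eq_bigr => i _; rewrite mxE exprMn.
Qed.

Lemma norm2_eq0 (R : realType) n (v : 'cV[R]_n) : (norm2 v == 0) = (v == 0).
Proof.
rewrite -sqrf_eq0 norm2_sqr psumr_eq0 => [|i _]; last exact: sqr_ge0.
apply/allP/eqP => [h|-> i _]; last by rewrite mxE expr0n /= eqxx.
apply/colP => i; rewrite mxE.
by have := h i (mem_index_enum _); rewrite sqrf_eq0 => /eqP.
Qed.

Lemma norm20 (R : realType) n : norm2 (0 : 'cV[R]_n) = 0.
Proof. by apply/eqP; rewrite norm2_eq0. Qed.

(** This Frobenius bound serves to make the set in [mxnorm2] bounded, so that its [sup] is a genuine
    supremum. *)
Lemma norm2_mulmx_frobenius (R : realType) p q (X : 'M[R]_(p, q)) (v : 'cV_q) :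
  norm2 (X *m v) <= Num.sqrt (\sum_i \sum_j X i j ^+ 2) * norm2 v.
Proof.
have X0 : 0 <= \sum_i \sum_j X i j ^+ 2.
  by apply: sumr_ge0 => i _; apply: sumr_ge0 => j _; exact: sqr_ge0.
rewrite -(ler_pXn2r (n := 2)) ?nnegrE ?mulr_ge0 ?norm2_ge0 ?sqrtr_ge0 //.
rewrite exprMn !norm2_sqr sqr_sqrtr // mulr_suml; apply: ler_sum => i _.
by rewrite mxE; exact: cauchy_schwarz_sum.
Qed.

Lemma has_sup_mxnorm2 (R : realType) p q (X : 'M[R]_(p, q)) :
  has_sup [set norm2 (X *m v) | v in [set v : 'cV[R]_q | norm2 v <= 1]].
Proof.
split.
  exists (norm2 (X *m 0)), 0 => //=.
  by rewrite norm20 ler01.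
exists (Num.sqrt (\sum_i \sum_j X i j ^+ 2)) => _ [v /= v1 <-].
apply: le_trans (norm2_mulmx_frobenius X v) _.
by rewrite ler_piMr // sqrtr_ge0.
Qed.

Lemma norm2_mulmx (R : realType) p q (X : 'M[R]_(p, q)) (v : 'cV_q) :
  norm2 (X *m v) <= mxnorm2 X * norm2 v.
Proof.
have [->|v0] := eqVneq v 0.
  by rewrite mulmx0 !norm20 mulr0.
have nv : 0 < norm2 v by rewrite lt_def norm2_eq0 v0 norm2_ge0.
rewrite -ler_pdivrMr //.
have -> : norm2 (X *m v) / norm2 v = norm2 (X *m ((norm2 v)^-1 *: v)).
  by rewrite -scalemxAr norm2Z ger0_norm ?invr_ge0 ?norm2_ge0 // mulrC.
apply: ub_le_sup; first by have [] := has_sup_mxnorm2 X.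
exists ((norm2 v)^-1 *: v) => //=.
by rewrite norm2Z ger0_norm ?invr_ge0 ?norm2_ge0 // mulVf ?gt_eqF.
Qed.

Lemma mxnorm2_ge0 (R : realType) p q (X : 'M[R]_(p, q)) : 0 <= mxnorm2 X.
Proof.
apply: le_trans (norm2_ge0 (X *m 0)) _.
apply: ub_le_sup; first by have [] := has_sup_mxnorm2 X.
exists 0 => //=.
by rewrite norm20 ler01.
Qed.

(** * Counting eigenvalues and singular values *)

Lemma count_eigenvalues_near (R : realType) m q (T : 'M[R]_m) (S : 'M[R]_(m, q))
    (c : R) (eps := mxnorm2 ((T - c%:M) *m S)) :
  T^T = T -> S^T *m S = 1%:M ->
  (q <= count [in (`[c - eps, c + eps] : interval R)%R] (eigenvalues T))%N.
Proof.
move=> symT SS.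
have [U [D [UU UU' UT]]] := spectral_theorem symT.
rewrite (count_eigenvalues _ UU UT).
have TU : T *m U^T = U^T *m diag_mx D.
  by rewrite -{1}symT -trmx_mul UT trmx_mul tr_diag_mx.
pose e i := (D 0 i - c) ^+ 2.
have eps0 : 0 <= eps by exact: mxnorm2_ge0.
have -> : #|[pred i | D 0 i \in (`[c - eps, c + eps] : interval R)]| =
    #|[pred i | (e i <= eps ^+ 2)%R]|.
  apply: eq_card => i; rewrite -[RHS]/((D 0 i - c) ^+ 2 <= eps ^+ 2).
  rewrite -[LHS]/(D 0 i \in (`[c - eps, c + eps] : interval R)) in_itv /=.
  rewrite -[RHS](ler_sqrt (R := R)) ?sqr_ge0 // !sqrtr_sqr (ger0_norm eps0).
  by rewrite ler_distl.
(* The columns of [S], written as rows in the eigenbasis of [T]. *)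
pose M := S^T *m U^T.
have MM : M *m M^T = 1%:M.
  by rewrite /M trmx_mul !trmxK mulmxA -(mulmxA _ U^T) UU' mulmx1.
apply: (dim_le_card_weights (M := M)).
  by apply/row_freeP; exists M^T.
move=> x.
have -> : \sum_i (x *m M) 0 i ^+ 2 = norm2 x^T ^+ 2.
  rewrite norm2_sqr_tr trmxK -mul_row_tr trmx_mul mulmxA -(mulmxA x) MM.
  by rewrite mulmx1.
(* In the eigenbasis [T - c%:M] multiplies the [i]-th coordinate by [D 0 i - c], so the weighted sum
   is a squared norm, which [eps] controls. *)
have -> : \sum_i e i * (x *m M) 0 i ^+ 2 = norm2 ((T - c%:M) *m S *m x^T) ^+ 2.
  rewrite norm2_sqr_tr -{2}[_ *m x^T]trmxK.
  set w := (_ *m x^T)^T; rewrite -(mul_row_tr_orthogonal w UU') mul_row_tr.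
  apply: eq_bigr => i _; rewrite /e -exprMn; congr (_ ^+ 2).
  rewrite /w !trmx_mul trmxK linearB /= symT tr_scalar_mx.
  rewrite -!mulmxA mulmxBl TU mul_scalar_mx -mul_mx_scalar -mulmxBr.
  rewrite !mulmxA -(mulmxA x) -/M.
  have -> : diag_mx D - c%:M = diag_mx (D - const_mx c).
    by rewrite linearB /= diag_const_mx.
  by rewrite mul_mx_diag !mxE mulrC.
by rewrite -exprMn lerXn2r ?nnegrE ?mulr_ge0 ?norm2_ge0 // norm2_mulmx.
Qed.

(** Courant-Fischer in counting form: the kernel of [N] has dimension [q - \rank N], so at least
    that many eigenvalues of [Y^T *m Y] are at most [C ^+ 2]. *)
Lemma num_rank_le (R : realType) p q k (Y : 'M[R]_(p, q)) (N : 'M[R]_(q, k))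
    (C : R) :
  0 <= C ->
  (forall v : 'rV_q, v *m N = 0 ->
    ((v *m Y^T) *m (v *m Y^T)^T) 0 0 <= C ^+ 2 * (v *m v^T) 0 0) ->
  (num_rank C Y <= \rank N)%N.
Proof.
move=> C0 hN; have symX : (Y^T *m Y)^T = Y^T *m Y by rewrite trmx_mul trmxK.
have [U [D [UU UU' UX]]] := spectral_theorem symX.
rewrite /num_rank /singular_values count_map (count_eigenvalues _ UU UX).
have -> : #|[pred i | C < Num.sqrt (D 0 i)]| =
    #|[predC [pred i | D 0 i <= C ^+ 2]]|.
  apply: eq_card => i; rewrite -[LHS]/(C < Num.sqrt (D 0 i)).
  rewrite -[RHS]/(~~ (D 0 i <= C ^+ 2)) -ltNge.
  (* For [D 0 i <= 0] the root is 0 (by convention if negative), and both sides are false because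
     [0 <= C]. *)
  have [D0|D0] := leP (D 0 i) 0.
    by rewrite ler0_sqrtr // !ltNge C0 (le_trans D0 (sqr_ge0 C)).
  by rewrite -{1}(ger0_norm C0) -sqrtr_sqr ltr_sqrt.
pose K := row_base (kermx N).
have freeM : row_free (K *m U^T).
  have freeU : row_free U^T by apply/row_freeP; exists U.
  by rewrite /row_free mxrankMfree // -/(row_free K) row_base_free.
have h := dim_le_card_weights (e := fun i => D 0 i) (C := C ^+ 2) freeM.
have /h : forall x : 'rV_(\rank (kermx N)),
    \sum_i D 0 i * (x *m (K *m U^T)) 0 i ^+ 2 <=
    C ^+ 2 * \sum_i (x *m (K *m U^T)) 0 i ^+ 2.
  move=> x; rewrite mulmxA -!mul_row_tr mul_row_tr_orthogonal //.
  have KN : K *m N = 0 by apply/sub_kermxP; rewrite eq_row_base.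
  have xN : x *m K *m N = 0 by rewrite -mulmxA KN mulmx0.
  have := hN _ xN; congr (_ <= _).
  (* The quadratic form of [Y^T *m Y] is diagonal in its eigenbasis, with coefficients [D 0 i]. *)
  rewrite trmx_mul trmxK mulmxA -(mulmxA _ Y^T).
  have -> : Y^T *m Y = U^T *m diag_mx D *m U.
    by rewrite -mulmxA -UX mulmxA UU' mul1mx.
  set w := _ *m K.
  rewrite !mulmxA -(mulmxA _ U) -[U *m w^T]trmxK trmx_mul trmxK mxE.
  apply: eq_bigr => i _; rewrite mul_mx_diag [LHS]mulrC !mxE.
  by rewrite mulrA mulrC expr2.
have := cardC [pred i | D 0 i <= C ^+ 2]; rewrite card_ord => cC.
rewrite mxrank_ker => h'.
by rewrite -(leq_add2l #|[pred i | D 0 i <= C ^+ 2]|) cC addnC -leq_subLR.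
Qed.

Lemma sigma_le (R : realType) p q (Y : 'M[R]_(p, q)) (C : R) r :
  0 <= C -> (num_rank C Y <= r)%N -> sigma r.+1 Y <= C.
Proof.
move=> C0; rewrite /sigma /num_rank /=; set s := singular_values Y => cs.
have ss : sorted >=%R s.
  apply: (homo_sorted (e := >=%R)); first by move=> x y; exact: ler_wsqrtr.
  by apply: sort_sorted => x y; exact: le_total.
(* [sigma r.+1] reads index [r]; beyond the end it is the default 0, at most [C]. *)
case: (leqP (size s) r) => [rs|rs]; first by rewrite nth_default.
rewrite leNgt; apply/negP => Cr.
suff : (r.+1 <= count (fun x => (C < x)%R) s)%N by rewrite leqNgt ltnS cs.
(* If the entry at index [r] exceeded [C], so would all of the first [r.+1] entries of this
   nonincreasing list. *)
rewrite -[s in count _ s](cat_take_drop r.+1) count_cat.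
have /eqP -> : count (fun x => (C < x)%R) (take r.+1 s) == size (take r.+1 s).
  rewrite -all_count; apply/(all_nthP 0) => i; rewrite size_takel // => ir.
  rewrite nth_take //; apply: lt_le_trans Cr _.
  apply: (sorted_leq_nth (leT := >=%R)) => //.
  - by move=> a b c ab ca; exact: le_trans ca ab.
  - by move=> a; exact: lexx.
  - by rewrite inE; apply: leq_ltn_trans rs; rewrite -ltnS.
by rewrite size_takel // leq_addr.
Qed.

(** * Range of the spectral projector *)

Lemma mulmx_tr_eq0 (R : realDomainType) m n (X : 'M[R]_(m, n)) :
  X *m X^T = 0 -> X = 0.
Proof.
move=> XX; apply/row_matrixP => i; rewrite row0.
apply/eqP/negPn/negP => /mul_row_tr_gt0; rewrite mul_row_tr lt_neqAle eq_sym.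
suff -> : \sum_j row i X 0 j ^+ 2 = (X *m X^T) i i by rewrite XX mxE eqxx.
by rewrite mxE; apply: eq_bigr => j _; rewrite !mxE.
Qed.

(** [E1 *m A *m E2^T] equals both [x] and [y] times [E1 *m E2^T]. *)
Lemma sym_eigenvectors_orthogonal (R : fieldType) n m1 m2 (A : 'M[R]_n)
    (E1 : 'M[R]_(m1, n)) (E2 : 'M[R]_(m2, n)) (x y : R) :
  A^T = A -> x != y -> E1 *m A = x *: E1 -> E2 *m A = y *: E2 ->
  E1 *m E2^T = 0.
Proof.
move=> symA xy E1A E2A.
have : x *: (E1 *m E2^T) = y *: (E1 *m E2^T).
  have -> : y *: (E1 *m E2^T) = E1 *m (y *: E2)^T.
    by rewrite linearZ /= scalemxAr.
  by rewrite -E2A trmx_mul symA mulmxA E1A scalemxAl.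
move/eqP; rewrite -subr_eq0 -scalerBl scaler_eq0 subr_eq0 (negbTE xy) /=.
by move/eqP.
Qed.

Lemma sumsmx_seq_sub (F : fieldType) (I : Type) (s : seq I) (P : pred I)
    (m n : nat) (E : I -> 'M[F]_n) (W : 'M[F]_(m, n)) :
  (forall x, P x -> (E x <= W)%MS) -> (\sum_(x <- s | P x) E x <= W)%MS.
Proof.
move=> h; apply: (big_ind (fun X : 'M_n => (X <= W)%MS)) => //.
  exact: sub0mx.
by move=> X X' XW X'W; rewrite addsmx_sub XW.
Qed.

(** The two sums are orthogonal, and orthogonal real subspaces meet trivially. This makes [proj_mx]
    the identity on the first sum. *)
Lemma capmx_eigenspaces (R : realFieldType) n (A : 'M[R]_n) (s : seq R)
    (P : pred R) :
  A^T = A ->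
  ((\sum_(x <- s | P x) eigenspace A x) :&:
   (\sum_(x <- s | ~~ P x) eigenspace A x))%MS = 0.
Proof.
move=> symA; set S1 := (\sum_(x <- s | P x) _)%MS.
set S2 := (\sum_(x <- s | _) _)%MS; set W := (S1 :&: S2)%MS.
have S12 : S1 *m S2^T = 0.
  (* Orthogonality as inclusion in a kernel allows one eigenspace at a time; transposing treats the
     other sum likewise. *)
  apply/sub_kermxP/sumsmx_seq_sub => x Px; apply/sub_kermxP.
  rewrite -[LHS]trmxK trmx_mul trmxK; apply: (canLR (@trmxK _ _ _)).
  rewrite trmx0; apply/sub_kermxP/sumsmx_seq_sub => y Py; apply/sub_kermxP.
  apply: (sym_eigenvectors_orthogonal (x := y) (y := x) symA).
  - by apply: contraNneq Py => ->.
  - exact/eigenspaceP.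
  - exact/eigenspaceP.
have /submxP[X1 W1] : (W <= S1)%MS by exact: capmxSl.
have /submxP[X2 W2] : (W <= S2)%MS by exact: capmxSr.
apply: mulmx_tr_eq0; rewrite {1}W1 W2 trmx_mul mulmxA -(mulmxA X1) S12.
by rewrite mulmx0 mul0mx.
Qed.

Lemma row_eigenvector (R : fieldType) n (A U : 'M[R]_n) (D : 'rV[R]_n) i :
  U *m A = diag_mx D *m U -> row i U *m A = D 0 i *: row i U.
Proof.
by move=> UA; rewrite -row_mul UA row_mul row_diag_mx -scalemxAl -rowE.
Qed.

(** The rows of [U] with eigenvalue in [I] are independent and fixed by the projector, so they lie
    in its row space. *)
Lemma card_le_rank_spectral_projector (R : realType) n (A U : 'M[R]_n)
    (D : 'rV[R]_n) (I : interval R) :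
  A^T = A -> U *m U^T = 1%:M -> U *m A = diag_mx D *m U ->
  (#|[pred i | (D 0 i \in I)%R]| <= \rank (spectral_projector A I))%N.
Proof.
move=> symA UU UA; set S := [pred i | _].
pose f := @enum_val _ S; pose V := rowsub f U.
have VV : V *m V^T = 1%:M.
  apply/matrixP => i j; have /matrixP/(_ (f i) (f j)) := UU.
  rewrite !mxE (inj_eq enum_val_inj) => <-.
  by apply: eq_bigr => k _; rewrite !mxE.
have freeV : row_free V by apply/row_freeP; exists V^T.
have VS : (V <= \sum_(x <- eigenvalues A | x \in I) eigenspace A x)%MS.
  apply/row_subP => j; rewrite row_rowsub.
  have Dj : D 0 (f j) \in I by have : f j \in S by exact: enum_valP.
  have Dm : D 0 (f j) \in eigenvalues A.
    by rewrite (perm_mem (perm_eigenvalues UU UA)) map_f // mem_enum.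
  rewrite (big_rem _ Dm) /= Dj; apply: submx_trans (addsmxSl _ _).
  by apply/eigenspaceP; exact: row_eigenvector.
have cap0 := capmx_eigenspaces (eigenvalues A) (fun x => x \in I) symA.
have := proj_mx_id cap0 VS.
rewrite -/(spectral_projector A I) => Vp.
move/eqP: freeV => {1}<-; rewrite -{1}Vp; exact: mxrankM_maxr.
Qed.

(** * Residual bounds and numerical rank of Ritz vectors *)

Lemma le_edist_inf_dist (R : realType) (S : set R) (gamma x y : R) :
  (gamma%:E <= edist_inf S x)%E -> S y -> gamma <= `|x - y|.
Proof.
move=> h Sy; rewrite leNgt; apply/negP => lt.
(* Balls are open, so bounding [edist] takes a radius strictly above the distance; the midpoint
   stays below [gamma]. *)
pose r := (`|x - y| + gamma) / 2.
have xr : `|x - y| < r by rewrite /r; lra.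
have rg : r < gamma by rewrite /r; lra.
have r0 : 0 < r by apply: le_lt_trans xr.
have : (edist (x, y) <= r%:E)%E by apply: edist_fin.
have e : (edist_inf S x <= edist (x, y))%E.
  by apply: ereal.ereal_inf_lbound; exists y.
move/(le_trans e)/(le_trans h); rewrite lee_fin => /le_lt_trans/(_ rg).
by rewrite ltxx.
Qed.

(** In the eigenbasis the residual has coordinates [(D 0 j - theta) * (U *m y) j 0]; for [j] in [P]
    the first factor is at least [gamma] in absolute value. *)
Lemma residual_bound (R : realType) n (A U : 'M[R]_n) (D : 'rV[R]_n)
    (P : pred 'I_n) (y : 'cV[R]_n) (theta gamma rho : R) :
  U *m U^T = 1%:M -> U *m A = diag_mx D *m U -> 0 < gamma ->
  (forall j, P j -> gamma <= `|theta - D 0 j|) ->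
  norm2 (A *m y - theta *: y) <= rho ->
  \sum_(j | P j) (U *m y) j 0 ^+ 2 <= (rho / gamma) ^+ 2.
Proof.
move=> UU UA g0 hP hr.
have r0 : 0 <= rho by apply: le_trans hr; exact: norm2_ge0.
rewrite expr_div_n ler_pdivlMr ?exprn_gt0 // mulr_suml.
apply: (@le_trans _ _ (norm2 (A *m y - theta *: y) ^+ 2)); last first.
  by rewrite lerXn2r ?nnegrE ?norm2_ge0.
have -> : norm2 (A *m y - theta *: y) ^+ 2 =
    norm2 (U *m (A *m y - theta *: y)) ^+ 2.
  rewrite !norm2_sqr_tr trmx_mul mulmxA -(mulmxA _ U^T) (mulmx1C UU).
  by rewrite mulmx1.
rewrite norm2_sqr [leRHS](bigID P) /= ler_wpDr //.
  by apply: sumr_ge0 => j _; exact: sqr_ge0.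
apply: ler_sum => j Pj.
have -> : (U *m (A *m y - theta *: y)) j 0 = (D 0 j - theta) * (U *m y) j 0.
  rewrite mulmxBr mulmxA UA -mulmxA mul_diag_mx -scalemxAr.
  by rewrite !mxE mulrBl.
rewrite exprMn mulrC ler_wpM2r ?sqr_ge0 // -(real_normK (num_real (_ - _))).
by rewrite distrC lerXn2r ?nnegrE ?hP // ltW.
Qed.

Lemma num_rank_ritz_vectors (R : realType) n q (A : 'M[R]_n) (I : interval R)
    (Y : 'M[R]_(n, q)) (theta : 'I_q -> R) (rho gamma : R) :
  A^T = A -> 0 <= rho -> 0 < gamma ->
  (forall i, norm2 (A *m col i Y - theta i *: col i Y) <= rho) ->
  (forall i, (gamma%:E <= edist_inf (spectrum A `\` [set` I]) (theta i))%E) ->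
  (num_rank (Num.sqrt q%:R * (rho / gamma)) Y <=
     \rank (spectral_projector A I))%N.
Proof.
move=> symA rho0 g0 hres hdist.
have [U [D [UU UU' UA]]] := spectral_theorem symA.
apply: leq_trans (card_le_rank_spectral_projector I symA UU UA).
set S := [pred i | _]; pose f := @enum_val _ S.
(* Row [i] of [L] holds the coordinates of column [i] of [Y] in the eigenbasis of [A]. *)
pose L := Y^T *m U^T.
(* The constraint [v *m colsub f L = 0] says that the combination of columns given by [v] has no
   component in [I]. *)
apply: leq_trans (rank_leq_col (colsub f L)).
apply: num_rank_le => [|v vN].
  by rewrite mulr_ge0 ?sqrtr_ge0 // divr_ge0 // ltW.
rewrite -(mul_row_tr_orthogonal _ UU') !mul_row_tr -mulmxA -/L.
rewrite (bigID (fun j => j \in S)) /= big1 ?add0r => [|j jS]; last first.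
  have := congr1 (fun X : 'rV_#|S| => X 0 (enum_rank_in jS j)) vN.
  rewrite mulmx_colsub !mxE -[f _]/(enum_val _) enum_rankK_in // => ->.
  by rewrite expr0n.
apply: (@le_trans _ _ (\sum_(j | j \notin S)
    (\sum_i v 0 i ^+ 2) * \sum_i L i j ^+ 2)).
  by apply: ler_sum => j _; rewrite mxE; exact: cauchy_schwarz_sum.
rewrite -mulr_sumr mulrC ler_wpM2r //.
  by apply: sumr_ge0 => i _; exact: sqr_ge0.
(* Each of the [q] columns contributes one [(rho / gamma) ^+ 2], whence the factor
   [Num.sqrt q%:R]. *)
have -> : (Num.sqrt q%:R * (rho / gamma)) ^+ 2 =
    \sum_(i < q) (rho / gamma) ^+ 2.
  by rewrite sumr_const card_ord exprMn sqr_sqrtr // mulr_natl.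
rewrite exchange_big /=; apply: ler_sum => i _.
have -> : \sum_(j | j \notin S) L i j ^+ 2 =
    \sum_(j | j \notin S) (U *m col i Y) j 0 ^+ 2.
  apply: eq_bigr => j _; congr (_ ^+ 2); rewrite !mxE.
  by apply: eq_bigr => k _; rewrite !mxE mulrC.
apply: (residual_bound UU UA g0 _ (hres i)) => j jS.
apply: le_edist_inf_dist (hdist i) _; split; last by move=> /=; apply/negP.
apply/eigenvalueP; exists (row j U); first exact: row_eigenvector.
apply/eqP => /rowP r0; have /matrixP/(_ j j)/eqP := UU.
rewrite !mxE eqxx big1 => [|k _]; first by rewrite eq_sym oner_eq0.
by have := r0 k; rewrite !mxE => ->; rewrite mul0r.
Qed.

(** * Residual identity for the test space, and the conclusion *)

Lemma shifted_mul_WZ (R : realType) m d (T G : 'M[R]_m) (c : R)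
    (Z : 'M[R]_(m, d)) :
  (T - c%:M) *m WZ G Z = defect T G *m Z + G *m RZ T c Z - RZ T c Z *m KZ G Z.
Proof.
have -> : WZ G Z = G *m Z - Z *m KZ G Z.
  by rewrite /WZ /KZ 2!mulmxBl mul1mx !mulmxA.
rewrite mulmxBr !mulmxA -/(RZ T c Z); congr (_ - _).
(* What remains is [(T - c%:M) *m G = defect T G + G *m (T - c%:M)]. *)
rewrite -mulmxDl; congr (_ *m Z).
by rewrite /defect mulmxBl mulmxBr scalar_mxC addrA subrK.
Qed.

Lemma WZ_orthogonal (R : realType) m d (G : 'M[R]_m) (Z : 'M[R]_(m, d)) :
  Z^T *m Z = 1%:M -> Z^T *m WZ G Z = 0.
Proof.
by move=> ZZ; rewrite /WZ !mulmxA mulmxBr mulmx1 mulmxA ZZ mul1mx subrr !mul0mx.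
Qed.

Theorem corollary7 (R : realType) (n k s : nat) (b : 'I_k.+1 -> nat)
  (A : 'M[R]_n)
  (V : 'M[R]_(n, \sum_i b i))
  (T : 'M[R]_(\sum_i b i))
  (W : 'M[R]_(n, s)) (H : 'M[R]_(s, b ord_max)) (F : 'M[R]_(n, \sum_i b i))
  (hA : A^T = A)
  (hV : forall i, (submxrow V i)^T *m submxrow V i = 1%:M)
  (hT : T^T = T) (hTtri : block_tridiagonal T)
  (hW : W^T *m W = 1%:M)
  (hrec : A *m V = V *m T + W *m H *m (last_block R b)^T + F)
  (d : nat) (hd : (1 <= d <= \sum_i b i)%N)
  (Z : 'M[R]_(\sum_i b i, d)) (hZ : Z^T *m Z = 1%:M)
  (c : R)
  (t : nat) (ht : (1 <= t <= \rank (WZ (V^T *m V) Z))%N)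
  (QW : 'M[R]_(\sum_i b i, t)) (sW : 'rV[R]_t) (PW : 'M[R]_(d, t))
  (htriplets : leading_singular_triplets (WZ (V^T *m V) Z) QW sW PW)
  (hsW : forall i, 0 < sW 0 i) :
  let eps := epsZ T (V^T *m V) c Z PW sW in
  let J : interval R := `[c - eps, c + eps] in
  let q := (d + t)%N in
  (q <= count [in J] (eigenvalues T))%N /\
  forall (I : interval R)
    (hI : isolated_spectral_interval A I)
    (hJI : {subset J <= I}),
  let r := \rank (spectral_projector A I) in
  forall (z : 'I_q -> 'cV[R]_(\sum_i b i)) (theta : 'I_q -> R)
    (hz : forall i j, (z i)^T *m z j = (i == j)%:R%:M)
    (heig : forall i, T *m z i = theta i *: z i)
    (htheta : forall i, theta i \in J)
    (hVz : forall i, V *m z i != 0),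
  let y i := (norm2 (V *m z i))^-1 *: (V *m z i) in
  let Y : 'M[R]_(n, q) := \matrix_(i, j) y j i 0 in
  forall (rho gamma : R) (hrho : 0 <= rho) (hgamma : 0 < gamma)
    (hres : forall i, norm2 (A *m y i - theta i *: y i) <= rho)
    (hdist : forall i,
      (gamma%:E <= edist_inf (spectrum A `\` [set` I]) (theta i))%E)
    (hqr : (r < q)%N),
  sigma r.+1 Y <= Num.sqrt q%:R * (rho / gamma) /\
  forall eta, Num.sqrt q%:R * (rho / gamma) <= eta ->
    (num_rank eta Y <= r)%N /\ (q - r <= redundancy eta Y)%N.
Proof.
move=> eps J q; split.
  have [QQ _ WP _ _] := htriplets.
  set G := V^T *m V in ht htriplets eps J QQ WP *.
  have us : diag_mx sW \in unitmx.
    rewrite unitmxE det_diag unitfE; apply/prodf_neq0 => i _.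
    by rewrite gt_eqF.
  (* Solving for [QW] transfers to it the orthogonality of [WZ] to [Z], and turns [(T - c%:M) *m QW]
     into the second block of [epsZ]. *)
  have QE : QW = WZ G Z *m PW *m invmx (diag_mx sW) by rewrite WP mulmxK.
  have ZQ : Z^T *m QW = 0 by rewrite QE 2!(mulmxA Z^T) WZ_orthogonal // !mul0mx.
  have QZ : QW^T *m Z = 0 by rewrite -[LHS]trmxK trmx_mul trmxK ZQ trmx0.
  have SS : (row_mx Z QW)^T *m row_mx Z QW = 1%:M.
    by rewrite tr_row_mx mul_col_row hZ QQ ZQ QZ -scalar_mx_block.
  have := count_eigenvalues_near c hT SS.
  by rewrite mul_mx_row QE 2!(mulmxA (T - c%:M)) shifted_mul_WZ.
move=> I hI hJI r z theta hz heig htheta hVz y Y rho gamma hrho hgamma.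
move=> hres hdist hqr.
set C := Num.sqrt q%:R * (rho / gamma).
have C0 : 0 <= C by rewrite mulr_ge0 ?sqrtr_ge0 // divr_ge0 // ltW.
have rC : (num_rank C Y <= r)%N.
  apply: num_rank_ritz_vectors hrho hgamma _ hdist => // i.
  have -> : col i Y = y i by apply/colP => j; rewrite !mxE.
  exact: hres.
split; first exact: sigma_le.
move=> eta Ceta.
have reta : (num_rank eta Y <= r)%N.
  (* Raising the threshold from [C] to [eta] can only lower the count. *)
  by apply: leq_trans rC; apply: sub_count => x /=; exact: le_lt_trans.
by split=> //; exact: leq_sub2l.
Qed.
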